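(* Let $(X,d)$ be a compact metric space with at least two points and let $f:X\to X$ be an expansive homeomorphism. Then $h_E^+(f)\le h_L^+(f)$ and $h_E^-(f)\le h_L^-(f)$.
   Context: A homeomorphism $f$ of a compact metric space $(X,d)$ is called expansive if there is $\gamma>0$ such that, for all $x,y\in X$, $d(f^k(x),f^k(y))<\gamma$ for all $k\in\mathbb{Z}$ implies $x=y$. The expansive constant $\gamma(f)$ is the largest such $\gamma$ (understood as the supremum of all such $\gamma$). If $f$ is expansive then so is $f^n$ for every integer $n\ge 1$, and one defines $$h_E^+(f)=\limsup_{n\to\infty}-\frac1n\log\gamma(f^n),\qquad h_E^-(f)=\liminf_{n\to\infty}-\frac1n\log\gamma(f^n)$$ (values in the extended reals). For an open cover $\mathcal{U}$ of $X$, the Lebesgue number $\delta(\mathcal{U})$ is the largest positive number (understood as the supremum, with value $+\infty$ and $-\log(+\infty)=-\infty$ allowed) such that every open ball of radius $\delta(\mathcal{U})$ is contained in some element of $\mathcal{U}$. Put $\mathcal{U}_f^n=\bigvee_{j=0}^{n-1}f^{-j}(\mathcal{U})$, i.e. the cover by all sets $\bigcap_{j=0}^{n-1}f^{-j}(U_j)$ with $U_j\in\mathcal{U}$, and $\delta_n(f,\mathcal{U})=\delta(\mathcal{U}_f^n)$. Define $$h_L^-(f,\mathcal{U})=\liminf_{n\to\infty}-\frac1n\log\delta_n(f,\mathcal{U}),\qquad h_L^+(f,\mathcal{U})=\limsup_{n\to\infty}-\frac1n\log\delta_n(f,\mathcal{U}),$$ $$h_L^-(f)=\sup_{\mathcal{U}}h_L^-(f,\mathcal{U}),\qquad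 h_L^+(f)=\sup_{\mathcal{U}}h_L^+(f,\mathcal{U}),$$ the suprema being over all open covers $\mathcal{U}$ of $X$. *)

(* Defs.v *)
From HB Require Import structures.
From mathcomp Require Import all_boot all_order all_algebra.
From mathcomp Require Import all_classical all_reals all_analysis.

Set Implicit Arguments.
Unset Strict Implicit.
Unset Printing Implicit Defensive.

Import Order.TTheory GRing.Theory Num.Theory.

Local Open Scope classical_set_scope.
Local Open Scope ring_scope.

Record homeo (X : topologicalType) := Homeo {
  hfun :> X -> X;
  hinv : X -> X;
  hfunK : cancel hfun hinv;
  hinvK : cancel hinv hfun;
  hfun_continuous : continuous hfun;
  hinv_continuous : continuous hinv }.

Lemma iter_cancel (X : Type) (f g : X -> X) (n : nat) :
  cancel f g -> cancel (iter n f) (iter n g).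
Proof. by move=> fK; elim: n => // n IHn x; rewrite iterSr iterS fK IHn. Qed.

Lemma iter_continuous (X : topologicalType) (f : X -> X) (n : nat) :
  continuous f -> continuous (iter n f).
Proof.
move=> fc; elim: n => [|n IHn] x; first exact: cvg_id.
by apply: (@continuous_comp _ _ _ (iter n f) f) => //; [exact: IHn|exact: fc].
Qed.

Definition homeo_iter (X : topologicalType) (f : homeo X) (n : nat) : homeo X :=
  Homeo (iter_cancel n (@hfunK X f)) (iter_cancel n (@hinvK X f))
    (@iter_continuous X _ n (@hfun_continuous X f))
    (@iter_continuous X _ n (@hinv_continuous X f)).

(* [Negz n] is the integer - n.+1 *)
Definition homeo_iterz (X : topologicalType) (f : homeo X) (k : int) : X -> X :=
  match k with
  | Posz n => iter n f
  | Negz n => iter n.+1 (hinv f)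
  end.

Section expansivity.
Context {R : realType} {X : metricType R}.
Implicit Types (f : homeo X) (UU : set (set X)) (n : nat).

Definition expansivity_constant f (c : R) : Prop :=
  0 < c /\
  forall x y : X,
    (forall k : int, mdist (homeo_iterz f k x) (homeo_iterz f k y) < c) -> x = y.

Definition expansive f : Prop := exists c : R, expansivity_constant f c.

Definition expansive_constant f : \bar R :=
  ereal_sup [set c%:E | c in expansivity_constant f].

(* The term of index n = 0 is 0 in the sequences below, because 0^-1 = 0; it
   does not affect limits. *)
Definition hE_seq f n : \bar R :=
  (- (n%:R^-1%:E * lne (expansive_constant (homeo_iter f n))))%E.

Definition hE_sup f : \bar R := limn_esup (hE_seq f).

Definition hE_inf f : \bar R := limn_einf (hE_seq f).

Definition open_cover UU : Prop :=
  (forall U, UU U -> open U) /\ \bigcup_(U in UU) U = [set: X].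

Definition lebesgue_number UU : \bar R :=
  ereal_sup [set d%:E | d in [set d : R |
    0 < d /\ forall x : X, exists2 U, UU U & ball x d `<=` U]].

Definition iter_cover f UU n : set (set X) :=
  [set \bigcap_(j < n) (iter j f @^-1` U j) |
    U in [set U : nat -> set X | forall j, (j < n)%N -> UU (U j)]].

Definition hL_seq f UU n : \bar R :=
  (- (n%:R^-1%:E * lne (lebesgue_number (iter_cover f UU n))))%E.

Definition hL_sup_cover f UU : \bar R := limn_esup (hL_seq f UU).

Definition hL_inf_cover f UU : \bar R := limn_einf (hL_seq f UU).

Definition hL_sup f : \bar R := ereal_sup [set hL_sup_cover f UU | UU in open_cover].

Definition hL_inf f : \bar R := ereal_sup [set hL_inf_cover f UU | UU in open_cover].

End expansivity.

(* Main.v *)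
Require Import Defs.
From mathcomp Require Import all_boot all_order all_algebra.
From mathcomp Require Import all_classical all_reals all_analysis.

(** Let [c] be an expansivity constant of [f] and let [UU] be an open cover such
    that any two points in a common element are at distance less than [c]. Suppose that every ball of
    radius [d] lies in an element of [iter_cover f UU n], where [n > 0], and that
    the orbits of [x] and [y] under [f^n] stay [d]-close. Then for every [k]
    the points [f^(nk) x] and [f^(nk) y] lie in a common element of
    [iter_cover f UU n], so that [f^(nk+j) x] and [f^(nk+j) y] lie in a common
    element of [UU] for every [j < n]. Division with remainder by [n] writes
    every integer as [nk+j] with [j < n] ([homeo_iterz_edivn]); hence the full
    [f]-orbits stay [c]-close, and [x = y]. So [d] is an expansivity constant
    of [f^n] ([expansivity_constant_iter]).

    Taking suprema, the Lebesgue number of [iter_cover f UU n] is at most the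
    expansive constant of [f^n]; applying the order-reversing map
    [- (1/n) log] yields a termwise inequality [hE_seq f n <= hL_seq f UU n]
    for this single cover [UU] ([hE_seq_le_hL_seq]). Both upper and lower limits
    preserve it, and the limits for one cover are bounded by the suprema over
    all covers. *)

Set Implicit Arguments.
Unset Strict Implicit.
Unset Printing Implicit Defensive.

Import Order.TTheory GRing.Theory Num.Theory.

Local Open Scope classical_set_scope.
Local Open Scope ring_scope.

(** The convention [lne x = -oo] for [x <= 0] extends monotonicity from the
    nonnegative extended reals to all of [\bar R]. The negative side matters: the
    [lebesgue_number] of a family whose elements hold no balls of uniform radius
    is [-oo], the supremum of the empty set. *)
Lemma le_lne (R : realType) (x y : \bar R) : (x <= y)%E -> (lne x <= lne y)%E.
Proof.
move=> xy; have [x0|x0] := leP x 0%E; first by rewrite (le0_lneNy x0) leNye.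
have y0 := lt_le_trans x0 xy.
by rewrite lee_lne ?in_itv //= ?leey ?andbT ltW.
Qed.

Lemma le_limn_esup (R : realType) (u v : (\bar R)^nat) :
  (forall n, u n <= v n)%E -> (limn_esup u <= limn_esup v)%E.
Proof.
move=> uv; apply: le_ereal_inf_tmp => _ [V V_oo <-].
apply: ge_ereal_inf; exists (ereal_sup [set u n | n in V]); first by exists V.
apply: ge_ereal_sup => _ [n Vn <-].
by apply: le_trans (uv n) _; apply: ereal_sup_ubound; exists n.
Qed.

Lemma le_limn_einf (R : realType) (u v : (\bar R)^nat) :
  (forall n, u n <= v n)%E -> (limn_einf u <= limn_einf v)%E.
Proof. by move=> uv; rewrite leeN2; apply: le_limn_esup => n; rewrite leeN2. Qed.

(** Euclidean division of the exponent, [m = n * k + j]; this is how a full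
    [f]-orbit is recovered from blocks of length [n] along an [f^n]-orbit. *)
Lemma homeo_iterz_edivn (X : topologicalType) (f : homeo X) (n : nat) (m : int) :
  (0 < n)%N -> exists (k : int) (j : nat), (j < n)%N /\
    forall x, homeo_iterz f m x = iter j f (homeo_iterz (homeo_iter f n) k x).
Proof.
move=> n0; case: m => m.
- exists (Posz (m %/ n)), (m %% n)%N; split; first exact: ltn_pmod.
  by move=> x; rewrite /= -iterM -iterD addnC -divn_eq.
- (* - m.+1 = n * - (m %/ n).+1 + (n - (m %% n).+1) *)
  have rn : (m %% n < n)%N by exact: ltn_pmod.
  exists (Negz (m %/ n)), (n - (m %% n).+1)%N; split; first by rewrite ltn_subrL.
  move=> x; rewrite [homeo_iterz _ (Negz (m %/ n)) x]/= -iterS -iterM.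
  have -> : ((m %/ n).+1 * n = n - (m %% n).+1 + m.+1)%N.
    by rewrite mulSn [in m.+1](divn_eq m n) -addnS addnCA subnK // addnC.
  by rewrite iterD (iter_cancel _ (@hinvK X f)).
Qed.

Section lebesgue_number_expansivity.
Context {R : realType} {X : metricType R}.
Implicit Types (f : homeo X) (UU : set (set X)) (c d : R).

(** Strict for each pair of points only: the diameter itself may equal [c], as
    it can for balls of radius [c / 2]. *)
Definition mesh_lt UU c :=
  forall U x y, UU U -> U x -> U y -> mdist x y < c.

Lemma open_cover_mesh_lt c : 0 < c -> exists2 UU, open_cover UU & mesh_lt UU c.
Proof.
move=> c0; have c20 : 0 < c / 2 by rewrite divr_gt0.
exists [set interior (ball x (c / 2)) | x in [set: X]].
  split=> [_ [x _ <-]|]; first exact: open_interior.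
  rewrite -subTset => x _; exists (interior (ball x (c / 2))); first by exists x.
  exact: nbhsx_ballx.
move=> _ x y [z _ <-] /interior_subset zx /interior_subset zy.
move: zx zy; rewrite !ballEmdist /= => zx zy.
apply: le_lt_trans (metric_triangle x z y) _.
by rewrite [c]splitr ltrD // metric_sym.
Qed.

(** Points at distance less than [d] share an element of [iter_cover f UU n], so
    their first [n] iterates under [f] share elements of [UU]; with division of
    exponents by [n], closeness along the [f^n]-orbit gives closeness along the
    [f]-orbit. *)
Lemma expansivity_constant_iter f UU c d n : (0 < n)%N ->
  expansivity_constant f c -> mesh_lt UU c -> 0 < d ->
  (forall x, exists2 U, iter_cover f UU n U & ball x d `<=` U) ->
  expansivity_constant (homeo_iter f n) d.
Proof.
move=> n0 [_ f_exp] UUc d0 d_cover; split=> // x y xy; apply: f_exp => m.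
have [k [j [jn eq_m]]] := homeo_iterz_edivn f m n0; rewrite !eq_m.
set x' := homeo_iterz _ k x; set y' := homeo_iterz _ k y.
have [_ [U UUU <-] sub] := d_cover x'.
apply: (UUc (U j)); first exact: UUU.
- by apply: (sub x') => //; exact: ballxx.
- by apply: (sub y') => //; rewrite ballEmdist; exact: xy.
Qed.

Lemma lebesgue_number_le_expansive_constant f UU c n : (0 < n)%N ->
  expansivity_constant f c -> mesh_lt UU c ->
  (lebesgue_number (iter_cover f UU n) <= expansive_constant (homeo_iter f n))%E.
Proof.
move=> n0 f_exp UUc; apply: ereal_sup_le => _ [d [d0 d_cover] <-].
exists d => //.
exact: expansivity_constant_iter f_exp UUc d0 d_cover.
Qed.

Lemma hE_seq_le_hL_seq f UU c : expansivity_constant f c -> mesh_lt UU c ->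
  forall n, (hE_seq f n <= hL_seq f UU n)%E.
Proof.
move=> f_exp UUc [|n]; rewrite /hE_seq /hL_seq.
  by rewrite invr0 !mul0e.
rewrite leeN2 lee_wpmul2l ?lee_fin ?invr_ge0 //.
exact/le_lne/(lebesgue_number_le_expansive_constant _ f_exp UUc).
Qed.

End lebesgue_number_expansivity.

Theorem theorem3p1 (R : realType) (X : metricType R) (f : homeo X)
  (X_compact : compact [set: X]%classic) (X_two : exists x y : X, x <> y)
  (f_expansive : expansive f) :
  (hE_sup f <= hL_sup f)%E /\ (hE_inf f <= hL_inf f)%E.
Proof.
have [c f_exp] := f_expansive.
have [UU UU_cover UUc] := @open_cover_mesh_lt R X c (proj1 f_exp).
have le_seq := hE_seq_le_hL_seq f_exp UUc.
split.
- apply: le_trans (le_limn_esup le_seq) _.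
  by apply: ereal_sup_ubound; exists UU.
- apply: le_trans (le_limn_einf le_seq) _.
  by apply: ereal_sup_ubound; exists UU.
Qed.
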